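(* Let $\mathcal{E}$ be a completely positive trace-preserving qubit channel with coherence-vector (affine) form $\vec\tau=A\vec\rho+\vec b$, and let $E=\{A\vec r+\vec b:\ \vec r\in\mathbb{R}^3,\ \|\vec r\|_2\le 1\}$. Let $(p_0,p_1)$ be a given input distribution ($p_0,p_1\ge 0$, $p_0+p_1=1$). Then the maximum of the probability of correct decision $$\mathrm{P}_c=p_{0|0}\,p_0+p_{1|1}\,p_1$$ over all pairs of input qubit states $\rho_0,\rho_1$ and all binary POVMs $\{\Pi_0,\Pi_1\}$ equals $$\max\left\{\frac{1+\max_{\vec\tau\in E}\|\vec\tau-2p_0\vec b\|_2}{2},\ p_0,\ p_1\right\}.$$
   Context: A qubit state is a $2\times2$ complex matrix $\rho=\rho^\dagger\ge 0$ with $\mathrm{tr}(\rho)=1$. A qubit channel is a linear completely positive trace-preserving map $\mathcal{E}$ on $2\times 2$ complex matrices. A binary POVM is a pair $\{\Pi_0,\Pi_1\}$ of positive semidefinite $2\times 2$ matrices with $\Pi_0+\Pi_1=I$. The transition probabilities are $p_{y|x}=\mathrm{tr}(\Pi_y\,\mathcal{E}(\rho_x))$ for $x,y\in\{0,1\}$. Coherence vector representation: every qubit state is uniquely $\rho=\frac12(I+\vec\rho\cdot\vec\sigma)$ with $\vec\rho\in\mathbb{R}^3$, $\|\vec\rho\|_2\le1$, where $\vec v\cdot\vec\sigma=v_1\sigma_x+v_2\sigma_y+v_3\sigma_z$ and $\sigma_x,\sigma_y,\sigma_z$ are the Pauli matrices. In this representation the channel acts as an affine map: if $\tau=\mathcal{E}(\rho)$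 then $\vec\tau=A\vec\rho+\vec b$, for a real $3\times3$ matrix $A$ and a vector $\vec b\in\mathbb{R}^3$ determined by $\mathcal{E}$. *)

(* Defs.v *)
From HB Require Import structures.
From mathcomp Require Import all_boot all_order all_algebra.
From mathcomp Require Import sesquilinear spectral complex.
From mathcomp Require Import classical_sets reals.

Set Implicit Arguments.
Unset Strict Implicit.
Unset Printing Implicit Defensive.

Import Order.TTheory GRing.Theory Num.Theory.
Local Open Scope ring_scope.
Local Open Scope sesquilinear_scope.
Local Open Scope complex_scope.
Local Open Scope classical_set_scope.

Definition is_maximum (R : realType) (S : set R) (m : R) : Prop :=
  S m /\ ubound S m.

(* Not the library norm `|v|, which on matrices is the sup norm. *)
Definition norm2 (R : realType) (n : nat) (v : 'cV[R]_n) : R :=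
  Num.sqrt (\sum_(i < n) v i 0 ^+ 2).

(* On R[i], [0 <= z] means that z is real and nonnegative. *)
Definition psd (R : realType) (n : nat) (X : 'M[R[i]]_n) : Prop :=
  X \is hermsymmx /\ forall v : 'cV[R[i]]_n, 0 <= (v ^t* *m X *m v) 0 0.

Definition qubit_state (R : realType) (rho : 'M[R[i]]_2) : Prop :=
  psd rho /\ \tr rho = 1.

(* id_k (x) E: a 2k x 2k matrix, viewed as an element of M_k (x) M_2, is a
   k x k array of 2 x 2 blocks, and E is applied to each block. *)
Definition ampliation (R : realType) (E : 'M[R[i]]_2 -> 'M[R[i]]_2) (k : nat)
    (X : 'M[R[i]]_(\sum_(i < k) 2)) : 'M[R[i]]_(\sum_(i < k) 2) :=
  \mxblock_(i < k, j < k) E (submxblock X i j).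

Definition completely_positive (R : realType)
    (E : 'M[R[i]]_2 -> 'M[R[i]]_2) : Prop :=
  forall (k : nat) (X : 'M[R[i]]_(\sum_(i < k) 2)),
    psd X -> psd (ampliation E X).

Definition trace_preserving (R : realType)
    (E : 'M[R[i]]_2 -> 'M[R[i]]_2) : Prop :=
  forall X : 'M[R[i]]_2, \tr (E X) = \tr X.

Definition qubit_channel (R : realType)
    (E : {linear 'M[R[i]]_2 -> 'M[R[i]]_2}) : Prop :=
  completely_positive E /\ trace_preserving E.

Definition binary_povm (R : realType) (Pi : 'I_2 -> 'M[R[i]]_2) : Prop :=
  (forall y, psd (Pi y)) /\ Pi 0 + Pi 1 = 1%:M.

(* p_{y|x}. The trace is a real number for states, channels and POVMs, so
   taking its real part only changes its type. *)
Definition transition_prob (R : realType) (E : 'M[R[i]]_2 -> 'M[R[i]]_2)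
    (rho Pi : 'I_2 -> 'M[R[i]]_2) (y x : 'I_2) : R :=
  complex.Re (\tr (Pi y *m E (rho x))).

Definition prob_correct (R : realType) (E : 'M[R[i]]_2 -> 'M[R[i]]_2)
    (p0 p1 : R) (rho Pi : 'I_2 -> 'M[R[i]]_2) : R :=
  transition_prob E rho Pi 0 0 * p0 + transition_prob E rho Pi 1 1 * p1.

Definition mx2 (T : Type) (a b c d : T) : 'M[T]_2 :=
  \matrix_(i < 2, j < 2)
    if i == 0 then (if j == 0 then a else b) else (if j == 0 then c else d).

Definition pauli (R : realType) (k : 'I_3) : 'M[R[i]]_2 :=
  tnth [tuple mx2 0 1 1 0; mx2 0 (0 -i* 1) (0 +i* 1) 0; mx2 1 0 0 (-1)] k.

(* The matrix (I + r . sigma) / 2 with coherence vector r. *)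
Definition coherence_mx (R : realType) (r : 'cV[R]_3) : 'M[R[i]]_2 :=
  2^-1 *: (1%:M + \sum_(k < 3) (r k 0)%:C *: pauli R k).

(* The coherence vectors of the qubit states are those of the closed unit
   ball. *)
Definition affine_form (R : realType) (E : 'M[R[i]]_2 -> 'M[R[i]]_2)
    (A : 'M[R]_3) (b : 'cV[R]_3) : Prop :=
  forall r : 'cV[R]_3, norm2 r <= 1 ->
    E (coherence_mx r) = coherence_mx (A *m r + b).

Definition output_ellipsoid (R : realType) (A : 'M[R]_3) (b : 'cV[R]_3) :
    set 'cV[R]_3 :=
  [set A *m r + b | r in [set r : 'cV[R]_3 | norm2 r <= 1]].

(* Main.v *)
Require Import Defs.
From HB Require Import structures.
From mathcomp Require Import all_boot all_order all_algebra.
From mathcomp Require Import sesquilinear spectral complex.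
From mathcomp Require Import classical_sets reals.
From mathcomp Require Import ring lra.
From mathcomp Require Import boolp topology normedtype realfun derive.

Set Implicit Arguments.
Unset Strict Implicit.
Unset Printing Implicit Defensive.

Import Order.TTheory GRing.Theory Num.Theory.
Local Open Scope ring_scope.
Local Open Scope complex_scope.
Local Open Scope classical_set_scope.

(** Write [Pi_0 = (a I + c . sigma) / 2]. Positivity of [Pi_0] and of
    [I - Pi_0] means [|c| <= min (a, 2 - a)], and
      [P_c = p1 + (a (p0 - p1) + c . w) / 2],
    where [w = A (p0 r0 - p1 r1) + (p0 - p1) b]. For a fixed [|w|] the best [c]
    is parallel to [w], and the resulting bound is affine in [a] on [[0, 1]] and
    on [[1, 2]], so the optimum is at [a = 0], [1] or [2], with the values [p1],
    [(1 + |w|) / 2] and [p0]. The vector [p0 r0 - p1 r1] ranges over the unit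
    ball, all of which is already reached with [r1 = - r0]; by the symmetry of
    the ball the maximum of [|w|] is that of [|tau - 2 p0 b|]. *)

(** * Euclidean inner product and norm on column vectors *)

Section EuclideanNorm.
Variables (R : realType) (n : nat).
Implicit Types (u v w : 'cV[R]_n) (a : R).

Definition dot u v : R := \sum_(i < n) u i 0 * v i 0.

Lemma dotDr u v w : dot u (v + w) = dot u v + dot u w.
Proof. by rewrite -big_split; apply: eq_bigr => i _; rewrite mxE mulrDr. Qed.

Lemma dotDl u v w : dot (u + v) w = dot u w + dot v w.
Proof. by rewrite -big_split; apply: eq_bigr => i _; rewrite mxE mulrDl. Qed.

Lemma dotC u v : dot u v = dot v u.
Proof. by apply: eq_bigr => i _; rewrite mulrC. Qed.

Lemma dotZr a u v : dot u (a *: v) = a * dot u v.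
Proof. by rewrite mulr_sumr; apply: eq_bigr => i _; rewrite mxE mulrCA. Qed.

Lemma dotZl a u v : dot (a *: u) v = a * dot u v.
Proof. by rewrite mulr_sumr; apply: eq_bigr => i _; rewrite mxE mulrA. Qed.

Lemma dotNr u v : dot u (- v) = - dot u v.
Proof. by rewrite -scaleN1r dotZr mulN1r. Qed.

Lemma dotNl u v : dot (- u) v = - dot u v.
Proof. by rewrite -scaleN1r dotZl mulN1r. Qed.

Lemma dot0l v : dot 0 v = 0.
Proof. by rewrite -(scale0r 0) dotZl mul0r. Qed.

Lemma norm2_ge0 v : 0 <= norm2 v.
Proof. exact: sqrtr_ge0. Qed.

Lemma sqr_norm2 v : norm2 v ^+ 2 = dot v v.
Proof.
rewrite sqr_sqrtr; last by apply: sumr_ge0 => i _; apply: sqr_ge0.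
by apply: eq_bigr => i _; rewrite expr2.
Qed.

Lemma norm2_eq0 v : norm2 v = 0 -> v = 0.
Proof.
move=> v0; apply/matrixP => i j; rewrite ord1 !mxE; apply/eqP.
rewrite -sqrf_eq0; apply/eqP.
apply: (psumr_eq0P (P := predT) (F := fun i => v i 0 ^+ 2)) => // [k _|].
  exact: sqr_ge0.
under eq_bigr do rewrite expr2.
by rewrite -[LHS]sqr_norm2 v0 expr0n.
Qed.

Lemma norm2_0 : norm2 (0 : 'cV[R]_n) = 0.
Proof. by apply/eqP; rewrite -sqrf_eq0 sqr_norm2 dot0l. Qed.

Lemma norm2Z a v : norm2 (a *: v) = `|a| * norm2 v.
Proof.
apply/eqP; rewrite -(@eqrXn2 _ 2) ?mulr_ge0 ?norm2_ge0 //.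
by rewrite exprMn !sqr_norm2 dotZl dotZr real_normK ?num_real // expr2 mulrA.
Qed.

Lemma norm2N v : norm2 (- v) = norm2 v.
Proof. by rewrite -scaleN1r norm2Z normrN1 mul1r. Qed.

(** Cauchy-Schwarz: with [s = |u|] and [t = |v|], expanding [|t u - s v|^2] gives
    [2 s t (s t - u . v)], and [s t > 0] outside the trivial cases. *)
Lemma dot_le_norm2 u v : dot u v <= norm2 u * norm2 v.
Proof.
have [/eqP/norm2_eq0->|u0] := boolP (norm2 u == 0).
  by rewrite dot0l norm2_0 mul0r.
have [/eqP/norm2_eq0->|v0] := boolP (norm2 v == 0).
  by rewrite -(scale0r 0) dotZr mul0r scale0r norm2_0 mulr0.
set s := norm2 u in u0 *; set t := norm2 v in v0 *.
have s_gt0 : 0 < s by rewrite lt_def u0 norm2_ge0.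
have t_gt0 : 0 < t by rewrite lt_def v0 norm2_ge0.
have : 0 <= \sum_(i < n) (t * u i 0 - s * v i 0) ^+ 2.
  by apply: sumr_ge0 => i _; apply: sqr_ge0.
rewrite (_ : \sum_(i < n) _ = t ^+ 2 * dot u u + s ^+ 2 * dot v v
  - 2 * (s * t) * dot u v); last first.
  rewrite !mulr_sumr -sumrN -!big_split /=.
  by apply: eq_bigr => i _; ring.
rewrite -!sqr_norm2 -/s -/t (_ : _ - _ = 2 * (s * t) * (s * t - dot u v)).
  by rewrite pmulr_rge0 ?subr_ge0// !mulr_gt0.
by ring.
Qed.

Lemma norm2D u v : norm2 (u + v) <= norm2 u + norm2 v.
Proof.
rewrite -(@ler_pXn2r _ 2) ?nnegrE ?addr_ge0 ?norm2_ge0 //.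
rewrite sqrrD !sqr_norm2 dotDr !dotDl (dotC v u).
by have := dot_le_norm2 u v; lra.
Qed.

End EuclideanNorm.

Lemma sum3 (V : zmodType) (F : 'I_3 -> V) : \sum_i F i = F 0 + F 1 + F 2%:R.
Proof.
rewrite !big_ord_recl big_ord0 addr0 addrA.
by congr (F _ + F _ + F _); apply: val_inj.
Qed.

(** * Bloch coordinates of Hermitian matrices, states and binary POVMs *)

Section BlochMatrix.
Variable R : realType.
Implicit Types (a : R) (c : 'cV[R]_3).

(* Half of [a I + c . sigma], so that its trace is [a] and [coherence_mx] is the
   case [a = 1]. *)
Definition bloch_mx a c : 'M[R[i]]_2 :=
  2^-1 *: ((a%:C)%:M + \sum_(k < 3) (c k 0)%:C *: pauli R k).

Lemma bloch_mxE a c : bloch_mx a c =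
  mx2 (((a + c 2%:R 0) / 2)%:C) (c 0 0 / 2 -i* (c 1 0 / 2))
      (c 0 0 / 2 +i* (c 1 0 / 2)) (((a - c 2%:R 0) / 2)%:C).
Proof.
have half : (2^-1 : R[i]) = (2^-1)%:C by rewrite fmorphV rmorph_nat.
rewrite /bloch_mx sum3 half; apply/matrixP => i j; rewrite !mxE.
case: i j => [[|[|//]] ?] [[|[|//]] ?]; rewrite /= ?mulr1n ?mulr0n;
  apply/eqP; rewrite eq_complex /=; apply/andP; split; apply/eqP; by field.
Qed.

Lemma mxtrace_bloch a c : \tr (bloch_mx a c) = a%:C.
Proof.
rewrite bloch_mxE /mxtrace !big_ord_recl big_ord0 addr0 !mxE /=.
by rewrite -rmorphD /=; congr (_%:C); field.
Qed.

Lemma mxtrace_mul_bloch a c a' c' :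
  \tr (bloch_mx a c *m bloch_mx a' c') = ((a * a' + dot c c') / 2)%:C.
Proof.
rewrite /dot sum3 !bloch_mxE /mxtrace !big_ord_recl big_ord0 addr0.
rewrite !mxE !big_ord_recl !big_ord0 !addr0 !mxE /=.
by apply/eqP; rewrite eq_complex /=; apply/andP; split; apply/eqP; field.
Qed.

Lemma bloch_mxD a c a' c' :
  bloch_mx a c + bloch_mx a' c' = bloch_mx (a + a') (c + c').
Proof.
rewrite /bloch_mx -scalerDr addrACA -big_split /=; congr (_ *: (_ + _)).
  by rewrite -raddfD -rmorphD.
by apply: eq_bigr => k _; rewrite mxE rmorphD scalerDl.
Qed.

Lemma bloch_mx_scalar a : bloch_mx a 0 = ((a / 2)%:C)%:M.
Proof.
rewrite bloch_mxE; apply/matrixP => i j; rewrite !mxE.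
by case: i j => [[|[|//]] ?] [[|[|//]] ?];
  rewrite /= ?mulr1n ?mulr0n ?mul0r ?oppr0 ?addr0.
Qed.

Lemma bloch_mx_herm a c : bloch_mx a c \is hermsymmx.
Proof.
apply/is_hermitianmxP; rewrite expr0 scale1r bloch_mxE.
apply/matrixP => i j; rewrite !mxE.
by case: i j => [[|[|//]] ?] [[|[|//]] ?];
  apply/eqP; rewrite eq_complex /= ?opprK ?oppr0 !eqxx.
Qed.

(** The identity and the Pauli matrices form a real basis of the Hermitian matrices; the coordinates
    are [a = tr X] and [c_k = tr (X sigma_k)]. *)
Lemma hermsymmx_bloch (X : 'M[R[i]]_2) :
  X \is hermsymmx -> exists a c, X = bloch_mx a c.
Proof.
move=> /is_hermitianmxP; rewrite expr0 scale1r => Xherm.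
have conjX i j : complex.Re (X i j) = complex.Re (X j i) /\
    complex.Im (X i j) = - complex.Im (X j i).
  by move: Xherm => /matrixP/(_ i j) ->; rewrite !mxE; case: (X j i).
have imX i : complex.Im (X i i) = 0 by have [_] := conjX i i; lra.
exists (complex.Re (X 0 0) + complex.Re (X 1 1)).
exists (\col_k tnth [tuple 2 * complex.Re (X 0 1); - 2 * complex.Im (X 0 1);
  complex.Re (X 0 0) - complex.Re (X 1 1)] k).
rewrite bloch_mxE !mxE !(tnth_nth 0) /=.
have o0 k : Ordinal (k : 0 < 2)%N = 0 by apply: val_inj.
have o1 k : Ordinal (k : 1 < 2)%N = 1 by apply: val_inj.
have [re01 im01] := conjX 1 0.
apply/matrixP => i j; rewrite !mxE.
case: i j => [[|[|//]] ?] [[|[|//]] ?]; rewrite ?o0 ?o1 /=;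
  apply/eqP; rewrite eq_complex /= ?imX ?re01 ?im01;
  by apply/andP; split; apply/eqP; field.
Qed.

Definition sqnormc (z : R[i]) : R := complex.Re z ^+ 2 + complex.Im z ^+ 2.

(* [v v^*] is half of [|v|^2 I + s . sigma], where [s] is this vector. *)
Definition spinor_vector (v : 'cV[R[i]]_2) : 'cV[R]_3 :=
  \col_k tnth [tuple
    2 * (complex.Re (v 0 0) * complex.Re (v 1 0)
         + complex.Im (v 0 0) * complex.Im (v 1 0));
    2 * (complex.Re (v 0 0) * complex.Im (v 1 0)
         - complex.Im (v 0 0) * complex.Re (v 1 0));
    sqnormc (v 0 0) - sqnormc (v 1 0)] k.

(** Since [v v^*] has rank at most one, its determinant [(|v|^4 - |s|^2) / 4] vanishes. *)
Lemma norm2_spinor_vector v :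
  norm2 (spinor_vector v) = sqnormc (v 0 0) + sqnormc (v 1 0).
Proof.
apply/eqP; rewrite -(@eqrXn2 _ 2) ?norm2_ge0 ?addr_ge0 ?sqr_ge0 //.
rewrite sqr_norm2 /dot sum3 !mxE !(tnth_nth 0) /= /sqnormc; apply/eqP; ring.
Qed.

Local Open Scope sesquilinear_scope.

(** The form is the trace of [bloch_mx a c] times [v v^*], whose Bloch coordinates are [|v|^2 = |s|]
    and [s]. *)
Lemma bloch_mx_form a c (v : 'cV[R[i]]_2) :
  (v ^t* *m bloch_mx a c *m v) 0 0 =
  ((a * norm2 (spinor_vector v) + dot c (spinor_vector v)) / 2)%:C.
Proof.
rewrite norm2_spinor_vector /dot sum3 bloch_mxE.
rewrite !mxE !big_ord_recl !big_ord0 !addr0 !mxE.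
rewrite !big_ord_recl !big_ord0 !addr0 !mxE !(tnth_nth 0) /= /sqnormc.
have -> : lift ord0 ord0 = 1 :> 'I_2 by apply: val_inj.
case: (v 0 0) => x1 x2; case: (v 1 0) => y1 y2 /=.
by apply/eqP; rewrite eq_complex /=; apply/andP; split; apply/eqP; field.
Qed.

(** The eigenvalues are [(a + |c|) / 2] and [(a - |c|) / 2]. Sufficiency is Cauchy-Schwarz;
    necessity tests the form on an eigenvector for the smaller one. *)
Lemma psd_bloch a c : psd (bloch_mx a c) <-> norm2 c <= a.
Proof.
split=> [[_ psdX]|le_ca]; last first.
  split=> [|v]; first exact: bloch_mx_herm.
  rewrite bloch_mx_form ler0c divr_ge0 //.
  have := dot_le_norm2 (- c) (spinor_vector v).
  rewrite dotNl norm2N => dot_le.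
  have := ler_wpM2r (norm2_ge0 (spinor_vector v)) le_ca; lra.
have {}psdX v : 0 <= a * norm2 (spinor_vector v) + dot c (spinor_vector v).
  by have := psdX v; rewrite bloch_mx_form ler0c pmulr_lge0// invr_gt0.
have sqr_n : norm2 c ^+ 2 = c 0 0 ^+ 2 + c 1 0 ^+ 2 + c 2%:R 0 ^+ 2.
  by rewrite sqr_norm2 /dot sum3 -!expr2.
set n := norm2 c in sqr_n *; have n_ge0 : 0 <= n := norm2_ge0 c.
(* an eigenvector of [c . sigma] for the eigenvalue [- n], if nonzero *)
pose v : 'cV[R[i]]_2 :=
  \col_i if i == 0 then (c 2%:R 0 - n)%:C else c 0 0 +i* c 1 0.
have := psdX v; rewrite norm2_spinor_vector /dot sum3 !mxE !(tnth_nth 0) /=.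
rewrite /sqnormc /=.
(* The second basis vector gives [z <= a], which settles the case [z = n], where [v] is zero. *)
have := psdX (\col_i (i != 0)%:R).
rewrite norm2_spinor_vector /dot sum3 !mxE !(tnth_nth 0) /= /sqnormc /=.
move: (c 0 0) (c 1 0) (c 2%:R 0) sqr_n => x y z sqr_n psd_e psd_v.
have x2 := sqr_ge0 x; have y2 := sqr_ge0 y.
have le_zn : z <= n.
  have [/le_trans->//|z_gt0] := leP z 0.
  by rewrite -(@ler_pXn2r _ 2) ?nnegrE ?(ltW z_gt0)// sqr_n; lra.
have [eq_zn|ne_zn] := eqVneq z n; first by rewrite -eq_zn; lra.
have lt_zn : z < n by rewrite lt_def eq_sym ne_zn.
have n_gt0 : 0 < n.
  rewrite lt_def n_ge0 andbT; apply: contra_ltN lt_zn => /eqP n0.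
  rewrite n0 expr0n /= in sqr_n *.
  have z2 := sqr_ge0 z; suff /eqP : z ^+ 2 = 0 by rewrite sqrf_eq0 => /eqP->.
  by lra.
(* Here [|v|^2 = 2 n (n - z)], and [a - n] is twice the eigenvalue at [v]. *)
move: psd_v; rewrite (_ : _ + _ = 2 * n * (n - z) * (a - n)).
  by rewrite pmulr_rge0 ?subr_ge0// !mulr_gt0 ?subr_gt0.
ring: sqr_n.
Qed.

Lemma coherence_mxE (r : 'cV[R]_3) : coherence_mx r = bloch_mx 1 r.
Proof. by rewrite /bloch_mx rmorph1. Qed.

Lemma qubit_stateP (rho : 'M[R[i]]_2) :
  qubit_state rho <-> exists2 r, norm2 r <= 1 & rho = coherence_mx r.
Proof.
split=> [[psd_rho tr_rho]|[r r_le1 ->]]; last first.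
  rewrite /qubit_state coherence_mxE mxtrace_bloch.
  by split=> //; apply/psd_bloch.
have [a [c rhoE]] := hermsymmx_bloch psd_rho.1.
move: psd_rho tr_rho; rewrite rhoE mxtrace_bloch psd_bloch => le_ca [a1].
by exists c; rewrite ?coherence_mxE -?a1.
Qed.

(** As [I = bloch_mx 2 0], passing from [Pi 0] to [I - Pi 0] sends [a] to [2 - a] and [c] to
    [- c]. *)
Lemma binary_povmP (Pi : 'I_2 -> 'M[R[i]]_2) :
  binary_povm Pi <-> exists a c, [/\ norm2 c <= a, norm2 c <= 2 - a,
    Pi 0 = bloch_mx a c & Pi 1 = bloch_mx (2 - a) (- c)].
Proof.
have one_bloch : 1%:M = bloch_mx 2 0.
  by rewrite bloch_mx_scalar divff ?pnatr_eq0.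
split=> [[psdPi sumPi]|[a [c [le_ca le_c2a Pi0 Pi1]]]]; last first.
  split=> [y|]; last by rewrite Pi0 Pi1 bloch_mxD subrr addrC subrK one_bloch.
  have [->|->] : y = 0 \/ y = 1.
    by case: y => [[|[|//]] ?]; [left|right]; apply: val_inj.
    by rewrite Pi0; apply/psd_bloch.
  by rewrite Pi1; apply/psd_bloch; rewrite norm2N.
have [a [c Pi0]] := hermsymmx_bloch (psdPi 0).1.
have Pi1 : Pi 1 = bloch_mx (2 - a) (- c).
  apply: (addrI (Pi 0)).
  by rewrite sumPi Pi0 bloch_mxD subrr addrC subrK one_bloch.
exists a, c; split => //; first by apply/psd_bloch; rewrite -Pi0.
by rewrite -norm2N; apply/psd_bloch; rewrite -Pi1.
Qed.


End BlochMatrix.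

(** * The success probability in Bloch coordinates and its scalar bound *)

Section DecisionProbability.
Variables (R : realType) (E : 'M[R[i]]_2 -> 'M[R[i]]_2).
Variables (A : 'M[R]_3) (b : 'cV[R]_3) (p0 p1 : R).
Hypotheses (formE : affine_form E A b) (sum_p : p0 + p1 = 1).

Lemma prob_correct_bloch (rho Pi : 'I_2 -> 'M[R[i]]_2) r0 r1 a c :
  norm2 r0 <= 1 -> norm2 r1 <= 1 ->
  rho 0 = coherence_mx r0 -> rho 1 = coherence_mx r1 ->
  Pi 0 = bloch_mx a c -> Pi 1 = bloch_mx (2 - a) (- c) ->
  prob_correct E p0 p1 rho Pi = p1 +
    (a * (p0 - p1)
     + dot c (A *m (p0 *: r0 - p1 *: r1) + (p0 - p1) *: b)) / 2.
Proof.
move=> r0_le1 r1_le1 rho0 rho1 Pi0 Pi1; rewrite /prob_correct /transition_prob.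
rewrite rho0 rho1 Pi0 Pi1 !formE // !coherence_mxE !mxtrace_mul_bloch /=.
rewrite dotNl mulmxBr -!scalemxAr scalerBl !(dotDr, dotNr, dotZr).
have -> : p0 = 1 - p1 by rewrite -sum_p addrK.
by field.
Qed.

End DecisionProbability.

(** Here [m] stands for [|c|] and [n] for [|w|]. For [a <= 1] the weights are [a] on [(1 + n) / 2]
    and [1 - a] on [p1]; for [a > 1] they are [2 - a] on [(1 + n) / 2] and [a - 1] on [p0]. *)
Lemma le_max_decision (R : realType) (p0 p1 a m n : R) :
  p0 + p1 = 1 -> 0 <= m -> m <= a -> m <= 2 - a -> 0 <= n ->
  p1 + (a * (p0 - p1) + m * n) / 2 <= Num.max ((1 + n) / 2) (Num.max p0 p1).
Proof.
move=> sum_p m_ge0 le_ma le_m2a n_ge0; have -> : p0 = 1 - p1 by lra.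
(* a convex combination of [(1 + n) / 2] with [p1] or with [p0] *)
set M := Num.max _ _.
have M1 : (1 + n) / 2 <= M by rewrite le_max lexx.
have M2 : 1 - p1 <= M by rewrite !le_max lexx orbT.
have M3 : p1 <= M by rewrite !le_max lexx !orbT.
have [a_le1|a_gt1] := leP a 1.
  have a_ge0 : 0 <= a by lra.
  have s_ge0 : 0 <= 1 - a by lra.
  have := ler_wpM2l a_ge0 M1; have := ler_wpM2l s_ge0 M3.
  by have := ler_wpM2r n_ge0 le_ma; lra.
have a_le2 : 0 <= 2 - a by lra.
have s_ge0 : 0 <= a - 1 by lra.
have := ler_wpM2l a_le2 M1; have := ler_wpM2l s_ge0 M2.
by have := ler_wpM2r n_ge0 le_m2a; lra.
Qed.

(** Equality in Cauchy-Schwarz, at [w / |w|], or at [0] if [w = 0]; it supplies the optimal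
    measurement direction. *)
Lemma dot_unit_norm2 (R : realType) n (w : 'cV[R]_n) :
  exists2 c, norm2 c <= 1 & dot c w = norm2 w.
Proof.
have [w0|w_neq0] := eqVneq (norm2 w) 0.
  by exists 0; rewrite ?norm2_0 // dot0l w0.
exists ((norm2 w)^-1 *: w); last first.
  by rewrite dotZl -sqr_norm2 expr2 mulKf.
by rewrite norm2Z ger0_norm ?invr_ge0 ?norm2_ge0 // mulVf.
Qed.

(** * Existence of the maximum over the ellipsoid *)

Section Compactness.
Import numFieldNormedType.Exports.

Lemma continuous_sum_ord (R : realType) (T : topologicalType) n
    (F : 'I_n -> T -> R) :
  (forall i, continuous (F i)) -> continuous (fun x => \sum_(i < n) F i x).
Proof.
move=> F_cont.
apply: (@continuous_big R 'I_n +%R 0 xpredT _ T (index_enum 'I_n) F).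
  exact: add_continuous.
by move=> i _; exact: F_cont.
Qed.

Lemma continuous_norm2 (R : realType) (T : topologicalType) n
    (g : T -> 'cV[R]_n) :
  (forall i, continuous (fun x => g x i 0)) ->
  continuous (fun x => norm2 (g x)).
Proof.
move=> g_cont x.
apply: (continuous_comp (g := Num.sqrt)); last exact: sqrt_continuous.
apply: continuous_sum_ord => i {}x.
exact: (continuousM (g_cont i x) (g_cont i x)).
Qed.

(** Makes the Euclidean ball bounded for the sup norm on matrices. *)
Lemma norm_coord_le_norm2 (R : realType) n (v : 'cV[R]_n) i :
  `|v i 0| <= norm2 v.
Proof.
rewrite -(@ler_pXn2r _ 2) ?nnegrE ?norm2_ge0 // real_normK ?num_real //.
rewrite sqr_norm2 /dot (bigD1 i) //= -expr2 lerDl.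
by apply: sumr_ge0 => j _; rewrite -expr2 sqr_ge0.
Qed.

(** The closed unit ball is compact by Heine-Borel, so the continuous function [|A r + d|] attains
    its maximum there. *)
Lemma norm2_affine_max (R : realType) m n (A : 'M[R]_(m, n)) (d : 'cV[R]_m) :
  exists2 s, norm2 s <= 1 &
    forall r, norm2 r <= 1 -> norm2 (A *m r + d) <= norm2 (A *m s + d).
Proof.
(* the compactness results of the library are about row vectors *)
pose ball : set 'rV[R]_n := [set r | norm2 r^T <= 1].
have tr_cont i : continuous (fun r : 'rV[R]_n => r^T i 0).
  have -> : (fun r : 'rV[R]_n => r^T i 0) = (fun r => r 0 i).
    by apply/funext => r; rewrite mxE.
  exact: coord_continuous.
have ball_compact : compact ball.
  apply: bounded_closed_compact.
    exists 1; split; first exact: num_real.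
    move=> M /ltW M_ge1 r r_ball; rewrite /Num.norm /= mx_normrE.
    apply: bigmax_le => [|[i j] _ /=]; first exact: le_trans M_ge1.
    apply: le_trans (le_trans r_ball M_ge1).
    by have := norm_coord_le_norm2 r^T j; rewrite mxE ord1.
  apply: (@preimage_closed _ _ (fun r : 'rV[R]_n => norm2 r^T)
    [set x | x <= 1]).
    by move=> r _; exact: continuous_norm2.
  exact: closed_le.
have [||s s_ball s_max] :=
    @EVT_max_rV R n (fun r => norm2 (A *m r^T + d)) ball _ ball_compact.
- by exists 0; rewrite /ball /= trmx0 norm2_0.
- apply: continuous_subspaceT; apply: continuous_norm2 => i r.
  have -> : (fun r : 'rV[R]_n => (A *m r^T + d) i 0) =
      (fun r => \sum_(j < n) A i j * r^T j 0) \+ (fun=> d i 0).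
    by apply/funext => t; rewrite !mxE.
  apply: continuousD; last exact: cst_continuous.
  apply: continuous_sum_ord => j {}r.
  by apply: continuousM; [exact: cst_continuous|exact: tr_cont].
exists s^T; first by move: s_ball; rewrite inE.
by move=> r r_le1; rewrite -[r]trmxK; apply: s_max; rewrite inE /ball /= trmxK.
Qed.

End Compactness.

(** * The maximal probability of correct decision *)

Theorem mainTheorem3 (R : realType)
    (E : {linear 'M[R[i]]_2 -> 'M[R[i]]_2}) (A : 'M[R]_3) (b : 'cV[R]_3)
    (p0 p1 : R)
    (channelE : qubit_channel E) (formE : affine_form E A b)
    (p0_ge0 : 0 <= p0) (p1_ge0 : 0 <= p1) (sum_p : p0 + p1 = 1) :
  exists2 M : R,
    is_maximum [set norm2 (tau - (2 * p0) *: b) | tau in output_ellipsoid A b] M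
  & is_maximum
      [set P : R | exists rho Pi : 'I_2 -> 'M[R[i]]_2,
        [/\ forall x, qubit_state (rho x), binary_povm Pi
          & P = prob_correct E p0 p1 rho Pi]]
      (Num.max ((1 + M) / 2) (Num.max p0 p1)).
Proof.
have p0E : p0 = 1 - p1 by rewrite -sum_p addrK.
have comb_le1 (r0 r1 : 'cV[R]_3) : norm2 r0 <= 1 -> norm2 r1 <= 1 ->
    norm2 (p0 *: r0 - p1 *: r1) <= 1.
  move=> r0_le1 r1_le1; apply: le_trans (norm2D _ _) _.
  rewrite norm2N !norm2Z !ger0_norm // -sum_p.
  by rewrite lerD // ler_piMr.
have [s s_le1 s_max] := norm2_affine_max A (- (p0 - p1) *: b).
set M := norm2 _ in s_max.
(* The coefficient of [b] is [1 - 2 p0 = - (p0 - p1)]. *)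
have tauE r : A *m r + b - (2 * p0) *: b = A *m r + (- (p0 - p1)) *: b.
  rewrite -addrA -scaleNr -{1}[b]scale1r -scalerDl; congr (_ + _ *: _).
  by rewrite p0E; ring.
have flip (r : 'cV[R]_3) :
    A *m (- r) + (p0 - p1) *: b = - (A *m r + (- (p0 - p1)) *: b).
  by rewrite mulmxN scaleNr opprB addrC.
exists M.
  split=> [|_ [_ [r r_le1 <-] <-]]; last by rewrite tauE; exact: s_max.
  by exists (A *m s + b); [exists s | rewrite tauE].
split=> [|_ [rho [Pi [rho_state /binary_povmP Pi_povm ->]]]].
  (* The antipodal pair [r0 = - s], [r1 = s] makes [p0 r0 - p1 r1 = - s]; only the POVM is left to
     choose. *)
  pose rho (x : 'I_2) := coherence_mx (if x == 0 then - s else s).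
  have rho_state x : qubit_state (rho x).
    apply/qubit_stateP; exists (if x == 0 then - s else s) => //.
    by case: ifP => _; rewrite ?norm2N.
  pose Pi (a : R) c (y : 'I_2) :=
    if y == 0 then bloch_mx a c else bloch_mx (2 - a) (- c).
  have attained a c : norm2 c <= a -> norm2 c <= 2 - a ->
      exists rho Pi : 'I_2 -> 'M[R[i]]_2,
        [/\ forall x, qubit_state (rho x), binary_povm Pi &
          p1 + (a * (p0 - p1) - dot c (A *m s + (- (p0 - p1)) *: b)) / 2 =
          prob_correct E p0 p1 rho Pi].
    move=> le_ca le_c2a; exists rho, (Pi a c); split=> //.
      by apply/binary_povmP; exists a, c.
    rewrite (prob_correct_bloch formE sum_p
      (r0 := - s) (r1 := s) (a := a) (c := c)) ?norm2N //.
    have -> : p0 *: - s - p1 *: s = - s.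
      by rewrite scalerN -opprD -scalerDl sum_p scale1r.
    by rewrite flip dotNr.
  have [||->] : [\/ Num.max ((1 + M) / 2) (Num.max p0 p1) = (1 + M) / 2,
      Num.max ((1 + M) / 2) (Num.max p0 p1) = p0
    | Num.max ((1 + M) / 2) (Num.max p0 p1) = p1].
  - have [_|_] := leP (Num.max p0 p1) ((1 + M) / 2); first by constructor 1.
    by have [_|_] := leP p0 p1; [constructor 3|constructor 2].
  (* With [a = 1], the measurement vector [- c] points along [w], which is minus the extremal
     vector. *)
  - move=> ->; have [c c_le1 cM] :=
      dot_unit_norm2 (A *m s + (- (p0 - p1)) *: b).
    have := attained 1 (- c); rewrite norm2N dotNl cM -/M /=.
    rewrite (_ : p1 + _ = (1 + M) / 2); last by rewrite p0E; field.
    by apply=> //; rewrite addrK.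
  (* [Pi 0 = I]: always decide 0. *)
  - move=> ->; have := attained 2 0; rewrite norm2_0 dot0l.
    rewrite (_ : p1 + _ = p0); last by rewrite p0E; field.
    by apply; rewrite ?subrr.
  (* [Pi 1 = I]: always decide 1. *)
  have := attained 0 0; rewrite norm2_0 dot0l.
  rewrite (_ : p1 + _ = p1); last by rewrite p0E; field.
  by apply; rewrite ?subr0.
have [a [c [le_ca le_c2a Pi0 Pi1]]] := Pi_povm.
have [/qubit_stateP [r0 r0_le1 rho0] /qubit_stateP [r1 r1_le1 rho1]] :=
  (rho_state 0, rho_state 1).
rewrite (prob_correct_bloch formE sum_p r0_le1 r1_le1 rho0 rho1 Pi0 Pi1).
have M_ge0 : 0 <= M by exact: norm2_ge0.
apply: le_trans (le_max_decision sum_p (norm2_ge0 c) le_ca le_c2a M_ge0).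
rewrite lerD2l ler_pM2r ?invr_gt0 // lerD2l.
apply: le_trans (dot_le_norm2 _ _) _; rewrite ler_wpM2l ?norm2_ge0 //.
(* With [q = p0 r0 - p1 r1], the vector [w] is minus the affine image of [- q], a point of the unit
   ball, so [|w| <= M]. *)
rewrite -[p0 *: r0 - _]opprK flip norm2N; apply: s_max.
by rewrite norm2N; exact: comb_le1.
Qed.
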